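(* Let $\mathcal{A}$ be a Lie conformal algebra. Any finite irreducible generalized conformal module $V$ over $\mathcal{A}$ falls into one of the following two classes: (a) (trivial module) $V\cong\mathbb{C}_\alpha$ for some $\alpha\in\mathbb{C}$; (b) (non-trivial module) $V$ is non-trivial and is free of finite rank as a $\mathbb{C}[\partial]$-module.
   Context: A Lie conformal algebra $\mathcal{A}$ is a $\mathbb{C}[\partial]$-module with a $\mathbb{C}$-bilinear map $\mathcal{A}\times\mathcal{A}\to\mathcal{A}[\lambda]$, $(a,b)\mapsto[a_\lambda b]$, such that $[\partial a_\lambda b]=-\lambda[a_\lambda b]$, $[a_\lambda\partial b]=(\partial+\lambda)[a_\lambda b]$, $[a_\lambda b]=-[b_{-\lambda-\partial}a]$ and $[a_\lambda[b_\mu c]]=[[a_\lambda b]_{\lambda+\mu}c]+[b_\mu[a_\lambda c]]$. A generalized conformal module $V$ over $\mathcal{A}$ is a $\mathbb{C}[\partial]$-module with a $\mathbb{C}$-bilinear map $\mathcal{A}\times V\to V[[\lambda]]$, $(a,v)\mapsto a_\lambda v$, such that for all $a,b\in\mathcal{A}$, $v\in V$: $(\partial a)_\lambda v=-\lambda a_\lambda v$, $a_\lambda(\partial v)=(\partial+\lambda)a_\lambda v$, and $a_\lambda(b_\mu v)-b_\mu(a_\lambda v)=[a_\lambda b]_{\lambda+\mu}v$ in $V[[\lambda,\mu]]$ (the action is extended coefficientwise to power series). It is finite if $V$ is finitely generated over $\mathbb{C}[\partial]$; trivial if $a_\lambda v=0$ for all $a\in\mathcal{A}$, $v\in V$, and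 non-trivial otherwise. A submodule is a $\mathbb{C}[\partial]$-submodule $W\subseteq V$ with $a_\lambda w\in W[[\lambda]]$ for all $a\in\mathcal{A}$, $w\in W$; $V$ is irreducible if $V\ne0$ and its only submodules are $0$ and $V$. For $\alpha\in\mathbb{C}$, $\mathbb{C}_\alpha=\mathbb{C}v$ is the one-dimensional trivial module with $\partial v=\alpha v$ and $\mathcal{A}_\lambda v=0$. *)

(* Defs.v *)
From HB Require Import structures.
From mathcomp Require Import all_boot all_order all_algebra.
From mathcomp Require Import finmap.
From mathcomp Require Import reals complex.

Set Implicit Arguments.
Unset Strict Implicit.
Unset Printing Implicit Defensive.

Import GRing.Theory.

Local Open Scope ring_scope.

(* A K[d]-module is an [lmodType {poly K}]: the derivation d acts as ['X *: _]
   and a scalar k of K acts as [k%:P *: _].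
   A formal power series  sum_n lambda^n f_n  in V[[lambda]] is the function
   f : nat -> V of its coefficients (plain powers lambda^n, no divided powers);
   a polynomial in V[lambda] is such a function with finite support, i.e. an
   element of [{fsfun nat -> V with 0}].  Series in V[[lambda, mu]] are
   functions nat -> nat -> V, with the exponent of lambda first. *)

Section Series.
Variables (K : fieldType) (V : lmodType {poly K}).

Definition mul_lambda (f : nat -> V) : nat -> V :=
  fun n => if n is m.+1 then f m else 0.

Definition mul_partial (f : nat -> V) : nat -> V := fun n => 'X *: f n.

(* The series obtained from  sum_(j, k) lambda^j nu^k f_(j, k)  by putting
   nu = lambda + mu: the monomial lambda^m mu^n occurs in
   lambda^j (lambda + mu)^k exactly when j <= m and k = m - j + n, with
   coefficient 'C(k, n). *)
Definition subst_add (f : nat -> nat -> V) : nat -> nat -> V := fun m n =>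
  \sum_(j < m.+1) f j (m - j + n)%N *+ 'C(m - j + n, n).

(* f(- lambda - d) = sum_n (- lambda - d)^n f_n, where in {poly {poly K}} the
   outer variable is lambda and the inner one is d. *)
Definition subst_opp (f : {fsfun nat -> V with 0}) : nat -> V := fun k =>
  \sum_(n <- finsupp f) ((- 'X - ('X : {poly K})%:P) ^+ n)`_k *: f n.

End Series.

(* [lc_bracket a b n] is the coefficient of lambda^n in [a_lambda b]. *)
Record lieConformalAlgebra (K : fieldType) := LieConformalAlgebra {
  lc_sort :> lmodType {poly K};
  lc_bracket : lc_sort -> lc_sort -> {fsfun nat -> lc_sort with 0};
  lc_bracket_linearl : forall (k : K) (a a' b : lc_sort) n,
    lc_bracket (k%:P *: a + a') b n
    = k%:P *: lc_bracket a b n + lc_bracket a' b n;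
  lc_bracket_linearr : forall (k : K) (a b b' : lc_sort) n,
    lc_bracket a (k%:P *: b + b') n
    = k%:P *: lc_bracket a b n + lc_bracket a b' n;
  lc_bracket_derivl : forall (a b : lc_sort) n,
    lc_bracket ('X *: a) b n = - mul_lambda (lc_bracket a b) n;
  lc_bracket_derivr : forall (a b : lc_sort) n,
    lc_bracket a ('X *: b) n
    = mul_partial (lc_bracket a b) n + mul_lambda (lc_bracket a b) n;
  lc_bracket_skew : forall (a b : lc_sort) n,
    lc_bracket a b n = - subst_opp (lc_bracket b a) n;
  lc_bracket_jacobi : forall (a b c : lc_sort) m n,
    lc_bracket a (lc_bracket b c n) m
    = subst_add (fun j k => lc_bracket (lc_bracket a b j) c k) m n
      + lc_bracket b (lc_bracket a c m) n
}.

(* [gc_act a v n] is the coefficient of lambda^n in a_lambda v. *)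
Record genConformalModule (K : fieldType) (A : lieConformalAlgebra K) :=
    GenConformalModule {
  gc_sort :> lmodType {poly K};
  gc_act : A -> gc_sort -> nat -> gc_sort;
  gc_act_linearl : forall (k : K) (a a' : A) (v : gc_sort) n,
    gc_act (k%:P *: a + a') v n = k%:P *: gc_act a v n + gc_act a' v n;
  gc_act_linearr : forall (k : K) (a : A) (v v' : gc_sort) n,
    gc_act a (k%:P *: v + v') n = k%:P *: gc_act a v n + gc_act a v' n;
  gc_act_derivl : forall (a : A) (v : gc_sort) n,
    gc_act ('X *: a) v n = - mul_lambda (gc_act a v) n;
  gc_act_derivr : forall (a : A) (v : gc_sort) n,
    gc_act a ('X *: v) n
    = mul_partial (gc_act a v) n + mul_lambda (gc_act a v) n;
  gc_act_comm : forall (a b : A) (v : gc_sort) m n,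
    gc_act a (gc_act b v n) m - gc_act b (gc_act a v m) n
    = subst_add (fun j k => gc_act (lc_bracket a b j) v k) m n
}.

Section Modules.
Variables (K : fieldType) (A : lieConformalAlgebra K).
Implicit Types V W : genConformalModule A.

Definition gc_finite V : Prop :=
  exists n (e : 'I_n -> V), forall v : V,
    exists c : 'I_n -> {poly K}, v = \sum_i c i *: e i.

Definition gc_free_finite_rank V : Prop :=
  exists n (e : 'I_n -> V), forall v : V,
    exists! c : {ffun 'I_n -> {poly K}}, v = \sum_i c i *: e i.

Definition gc_trivial V : Prop :=
  forall (a : A) (v : V) n, gc_act a v n = 0.

Record gc_submodule V (W : V -> Prop) : Prop := GcSubmodule {
  gc_submod0 : W 0;
  gc_submodD : forall v w, W v -> W w -> W (v + w);
  gc_submodZ : forall (p : {poly K}) v, W v -> W (p *: v);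
  gc_submod_act : forall (a : A) v n, W v -> W (gc_act a v n)
}.

Definition gc_irreducible V : Prop :=
  (exists v : V, v != 0) /\
  (forall W : V -> Prop, gc_submodule W ->
     (forall v, W v <-> v = 0) \/ (forall v, W v)).

Definition gc_isomorphic V W : Prop :=
  exists f : {linear V -> W},
    bijective f /\ forall (a : A) (v : V) n, f (gc_act a v n) = gc_act a (f v) n.

End Modules.

(* K with d acting as multiplication by alpha *)
Definition line (K : fieldType) (alpha : K) : Type := K.

Section Line.
Variables (K : fieldType) (alpha : K).

HB.instance Definition _ := GRing.Zmodule.on (line alpha).

Definition line_scale (p : {poly K}) (v : line alpha) : line alpha :=
  p.[alpha] * (v : K).

Fact line_scalerA p q v :
  line_scale p (line_scale q v) = line_scale (p * q) v.
Proof. by rewrite /line_scale hornerM mulrA. Qed.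

Fact line_scale1r : left_id 1 line_scale.
Proof. by move=> v; rewrite /line_scale hornerC mul1r. Qed.

Fact line_scalerDr : right_distributive line_scale +%R.
Proof. by move=> p v w; rewrite /line_scale mulrDr. Qed.

Fact line_scalerDl v : {morph line_scale^~ v : p q / p + q}.
Proof. by move=> p q; rewrite /line_scale hornerD mulrDl. Qed.

HB.instance Definition _ := GRing.Zmodule_isLmodule.Build {poly K} (line alpha)
  line_scalerA line_scale1r line_scalerDr line_scalerDl.

Variable A : lieConformalAlgebra K.

Definition line_act (a : A) (v : line alpha) (n : nat) : line alpha := 0.

Fact line_act_linearl (k : K) (a a' : A) (v : line alpha) n :
  line_act (k%:P *: a + a') v n = k%:P *: line_act a v n + line_act a' v n.
Proof. by rewrite /line_act scaler0 addr0. Qed.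

Fact line_act_linearr (k : K) (a : A) (v v' : line alpha) n :
  line_act a (k%:P *: v + v') n = k%:P *: line_act a v n + line_act a v' n.
Proof. by rewrite /line_act scaler0 addr0. Qed.

Fact line_act_derivl (a : A) (v : line alpha) n :
  line_act ('X *: a) v n = - mul_lambda (line_act a v) n.
Proof. by case: n => [|n]; rewrite /= oppr0. Qed.

Fact line_act_derivr (a : A) (v : line alpha) n :
  line_act a ('X *: v) n
  = mul_partial (line_act a v) n + mul_lambda (line_act a v) n.
Proof. by rewrite /mul_partial scaler0 add0r; case: n. Qed.

Fact line_act_comm (a b : A) (v : line alpha) m n :
  line_act a (line_act b v n) m - line_act b (line_act a v m) n
  = subst_add (fun j k => line_act (lc_bracket a b j) v k) m n.
Proof.
by rewrite /subst_add big1 => [|j _]; rewrite ?mul0rn // /line_act subr0.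
Qed.

Definition trivial_line : genConformalModule A :=
  GenConformalModule line_act_linearl line_act_linearr line_act_derivl
    line_act_derivr line_act_comm.

End Line.

(* Main.v *)
Require Import Defs.
From HB Require Import structures.
From mathcomp Require Import all_boot all_order all_algebra.
From mathcomp Require Import boolp.
From mathcomp Require Import reals complex.

(** If [p(d) v = 0] with [p] nonzero, then [p(d + lambda) a_lambda v = 0].
    Splitting [p] into linear factors, each factor [d + lambda - z] is injective
    on [V[[lambda]]]: a series [f] in its kernel has torsion coefficients with
    [f_n = - (d - z) f_(n+1)], and torsion is bounded because [V] is finitely
    generated.  So [A] acts by zero on the torsion submodule, which by
    irreducibility is [0] or [V].  A non-trivial [V] is thus torsion-free,
    hence free; a trivial [V] is a simple [C[d]]-module, i.e. a line. *)

Import GRing.Theory.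

Local Open Scope ring_scope.

Definition generates {R : nzRingType} {V : lmodType R} {n} (e : 'I_n -> V) :=
  forall v, exists c : 'I_n -> R, v = \sum_i c i *: e i.

Definition torsion {R : nzRingType} {V : lmodType R} (v : V) :=
  exists2 p : R, p != 0 & p *: v = 0.

(** * Bounded torsion in finitely generated modules over a domain *)

Section BoundedTorsion.
Variables (R : idomainType) (V : lmodType R).

(* The submodule [W] stands for the quotient [V / W], so that the induction can
   kill the generators one at a time. *)
Lemma bounded_torsion_mod n (e : 'I_n -> V) (W : V -> Prop) :
    W 0 -> (forall p v w, W v -> W w -> W (p *: v + w)) ->
    (forall v, exists c : 'I_n -> R, W (v - \sum_i c i *: e i)) ->
  exists2 d : R, d != 0 &
    forall p u, p != 0 -> W (p *: u) -> W (d *: u).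
Proof.
elim: n e W => [|n IHn] e W W0 WL gen.
  exists 1 => [|p u _ _]; first exact: oner_neq0.
  by have [c] := gen (1 *: u); rewrite big_ord0 subr0.
have WZ p v : W v -> W (p *: v) by move=> Wv; rewrite -[p *: v]addr0; apply: WL.
have WD v w : W v -> W w -> W (v + w).
  by move=> Wv Ww; rewrite -[v]scale1r; apply: WL.
pose W' v := exists q, W (v - q *: e ord0).
have W'0 : W' 0 by exists 0; rewrite scale0r subr0.
have W'L p v w : W' v -> W' w -> W' (p *: v + w).
  move=> [q Wq] [r Wr]; exists (p * q + r).
  by rewrite scalerDl opprD addrACA -scalerA -scalerBr; apply: WL.
have gen' v : exists c : 'I_n -> R, W' (v - \sum_i c i *: e (lift ord0 i)).
  have [c Wc] := gen v; exists (fun i => c (lift ord0 i)); exists (c ord0).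
  by rewrite -addrA -opprD addrC [X in - X]addrC -(big_ord_recl _ (fun i => c i *: e i)) addrC.
have [d d0 dW'] := IHn _ _ W'0 W'L gen'.
have W'P p u : p != 0 -> W (p *: u) -> W' (d *: u).
  by move=> p0 Wpu; apply: dW' p0 _; exists 0; rewrite scale0r subr0.
(* Modulo [W], [d *: u] is a multiple [q *: e ord0]. If [e ord0] is torsion modulo [W], its
   annihilator [c] absorbs this multiple. Otherwise [q] vanishes, because [p * q] sends [e ord0]
   into [W]. *)
have [[c c0 Wc]|ntor] := pselect (exists2 c, c != 0 & W (c *: e ord0)).
  exists (c * d) => [|p u p0 /(W'P _ _ p0)[q Wq]]; first by rewrite mulf_neq0.
  rewrite -[_ *: u](subrK (q *: (c *: e ord0))) -scalerA.
  by apply: WD; [rewrite [q *: _]scalerA [q * c]mulrC -scalerA -scalerBr|]; apply: WZ.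
exists d => // p u p0 Wpu; have [q Wq] := W'P _ _ p0 Wpu.
have [q0|qn0] := eqVneq q 0; first by move: Wq; rewrite q0 scale0r subr0.
case: ntor; exists (p * q); first by rewrite mulf_neq0.
have -> : (p * q) *: e ord0 = (- p) *: (d *: u - q *: e ord0) + d *: (p *: u).
  by rewrite scalerBr !scaleNr !scalerA opprK [d * p]mulrC addrC addNKr.
by apply: WL => //; apply: WZ.
Qed.

Lemma bounded_torsion n (e : 'I_n -> V) : generates e ->
  exists2 d : R, d != 0 & forall u : V, torsion u -> d *: u = 0.
Proof.
move=> gen; have [|p v w -> ->|v|d d0 dP] := @bounded_torsion_mod n e (eq^~ 0).
- by [].
- by rewrite scaler0 addr0.
- by have [c {1}->] := gen v; exists c; rewrite subrr.
by exists d => // u [p p0]; apply: dP.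
Qed.

End BoundedTorsion.

(** * Freeness of finitely generated torsion-free modules over [{poly F}] *)

Section TorsionFree.
Variables (F : fieldType) (V : lmodType {poly F}).
Hypothesis tfree : forall v : V, torsion v -> v = 0.

(* Euclid's algorithm on the coefficients of the relation. *)
Lemma drop_generator n (e : 'I_n.+1 -> V) (c : 'I_n.+1 -> {poly F}) :
    generates e -> (exists i, c i != 0) -> \sum_i c i *: e i = 0 ->
  exists e' : 'I_n -> V, generates e'.
Proof.
have [m] := ubnP (\sum_i size (c i)).
elim: m e c => // m IHm e c ltm gen [i ci0] rel.
have [/existsP[j /andP[ji cj0]]|] := boolP [exists j, (j != i) && (c j != 0)];
  last first.
  move=> /existsPn cj0; exists (fun k => e (lift i k)) => v.
  have ei0 : e i = 0.
    apply: tfree; exists (c i) => //; move: rel.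
    rewrite (bigD1 i) //= big1 ?addr0 // => j ji.
    by have := cj0 j; rewrite ji negbK => /eqP->; rewrite scale0r.
  have [b ->] := gen v; exists (fun k => b (lift i k)).
  by rewrite (bigD1_ord i) //= ei0 scaler0 add0r.
wlog le_ji : i j ci0 ji cj0 / (size (c j) <= size (c i))%N => [wl|].
  have [|/ltnW] := leqP (size (c j)) (size (c i)); first exact: wl.
  by apply: wl => //; rewrite eq_sym.
have ij : i != j by rewrite eq_sym.
(* Replacing [e j] by [e j + q *: e i] keeps the family generating and turns [c i] into its
   remainder modulo [c j], so the sum of sizes drops. *)
pose q := c i %/ c j.
pose e' k := if k == j then e j + q *: e i else e k.
pose c' k := if k == i then c i %% c j else c k.
have sum_e' b : \sum_k b k *: e' k = (b i + b j * q) *: e i +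
    (b j *: e j + \sum_(k | (k != i) && (k != j)) b k *: e k).
  rewrite (bigD1 i) //= (bigD1 j) //= /e' eqxx (negPf ij) scalerDr scalerA.
  rewrite scalerDl -!addrA; congr (_ + _); rewrite addrCA; congr (_ + (_ + _)).
  by apply: eq_bigr => k /andP[_ /negPf->].
have sum_e b : \sum_k b k *: e k = b i *: e i +
    (b j *: e j + \sum_(k | (k != i) && (k != j)) b k *: e k).
  by rewrite (bigD1 i) //= (bigD1 j).
apply: (IHm e' c').
- have lt_size : (\sum_k size (c' k) < \sum_k size (c k))%N.
    rewrite (bigD1 i) //= [X in (_ < X)%N](bigD1 i) //= {1}/c' eqxx.
    rewrite [X in (_ + X < _)%N](eq_bigr (fun k => size (c k))) => [|k /negPf ki].
      by rewrite ltn_add2r (leq_trans _ le_ji) // ltn_modp.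
    by rewrite /c' ki.
  by rewrite -ltnS (leq_trans _ ltm).
- move=> v; have [b ->] := gen v.
  exists (fun k => if k == i then b i - b j * q else b k).
  rewrite sum_e sum_e' eqxx (negPf ji) subrK; congr (_ + (_ + _)).
  by apply: eq_bigr => k /andP[/negPf->].
- by exists j; rewrite /c' (negPf ji).
- rewrite -[RHS]rel sum_e sum_e' /c' eqxx (negPf ji) [_ + c j * q]addrC mulrC.
  rewrite -divp_eq; congr (_ + (_ + _)).
  by apply: eq_bigr => k /andP[/negPf->].
Qed.

(** A nontrivial relation allows one generator fewer; a generating family without one is already a
    basis. *)
Lemma torsion_free_basis n (e : 'I_n -> V) : generates e ->
  exists m (b : 'I_m -> V), forall v : V,
    exists! c : {ffun 'I_m -> {poly F}}, v = \sum_i c i *: b i.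
Proof.
elim: n e => [|n IHn] e gen.
  exists 0%N, e => v; have [c ->] := gen v; exists [ffun i => c i].
  split=> [|c' _]; first by rewrite !big_ord0.
  by apply/ffunP=> -[].
have [[c [cn0 rel]]|free] := pselect (exists c : 'I_n.+1 -> {poly F},
    (exists i, c i != 0) /\ \sum_i c i *: e i = 0).
  by have [e' /IHn] := drop_generator _ _ _ gen cn0 rel.
exists n.+1, e => v; have [c ->] := gen v; exists [ffun i => c i].
split=> [|c' eq_cc']; first by apply: eq_bigr => i _; rewrite ffunE.
apply/ffunP=> i; rewrite ffunE; apply/eqP; rewrite -subr_eq0.
apply: contra_notT free => ci; exists (fun i => c i - c' i); split; first by exists i.
rewrite (eq_bigr (fun i => c i *: e i - c' i *: e i)) => [|k _].
  by rewrite sumrB eq_cc' subrr.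
by rewrite scalerBl.
Qed.

End TorsionFree.

(** * Linear factors and eigenvectors of the derivation *)

Lemma scale_eigen {F : fieldType} {V : lmodType {poly F}} {z : F} {w : V} p :
  ('X - z%:P) *: w = 0 -> p *: w = p.[z]%:P *: w.
Proof.
move=> zw; apply/eqP; rewrite -subr_eq0 -scalerBl; apply/eqP.
have /factor_theorem[q ->] : root (p - p.[z]%:P) z.
  by rewrite /root hornerD hornerN hornerC subrr.
by rewrite -scalerA zw scaler0.
Qed.

(** Algebraic closedness enters here: an annihilator, once made monic, splits into linear
    factors. *)
Lemma torsion_prod_XsubC {F : closedFieldType} {V : lmodType {poly F}} {v : V} :
  torsion v -> exists s : seq F, \prod_(z <- s) ('X - z%:P) *: v = 0.
Proof.
move=> [p p0 pv]; have [s def_p] := closed_field_poly_normal p.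
exists s; set q := \prod_(z <- s) _.
have -> : q = (lead_coef p)^-1 *: p.
  by rewrite {2}def_p scalerA mulVf ?lead_coef_eq0 // scale1r.
by rewrite -mul_polyC -scalerA pv scaler0.
Qed.

Lemma exists_eigenvector {F : closedFieldType} {V : lmodType {poly F}} {v : V} :
  torsion v -> v != 0 -> exists (z : F) (w : V), w != 0 /\ ('X - z%:P) *: w = 0.
Proof.
move=> /torsion_prod_XsubC[s] + v0.
elim: s v v0 => [|z s IHs] v v0; first by rewrite big_nil scale1r => /eqP/(negP v0).
rewrite big_cons mulrC -scalerA.
have [zv _|zv] := eqVneq (('X - z%:P) *: v) 0; last exact: IHs.
by exists z, v.
Qed.

(** * The action on torsion elements *)

Section Action.
Variables (K : fieldType) (A : lieConformalAlgebra K) (V : genConformalModule A).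
Implicit Types (a : A) (v : V).

Lemma gc_actD a v w n : gc_act a (v + w) n = gc_act a v n + gc_act a w n.
Proof. by rewrite -[v]scale1r gc_act_linearr !scale1r. Qed.

Lemma gc_act0 a n : gc_act a (0 : V) n = 0.
Proof. by apply: (addrI (gc_act a 0 n)); rewrite -gc_actD !addr0. Qed.

Lemma gc_act_XsubC a v z n : gc_act a (('X - z%:P) *: v) n =
  ('X - z%:P) *: gc_act a v n + mul_lambda (gc_act a v) n.
Proof.
have -> : ('X - z%:P) *: v = (- z)%:P *: v + 'X *: v.
  by rewrite -scalerDl polyCN addrC.
rewrite gc_act_linearr gc_act_derivr /mul_partial addrA -scalerDl polyCN.
by rewrite [- _ + _]addrC.
Qed.

End Action.

(* Injectivity of [d + lambda - z] on [V[[lambda]]]. *)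
Lemma shift_series_eq0 (F : fieldType) (V : lmodType {poly F}) n
    (e : 'I_n -> V) (z : F) (f : nat -> V) : generates e ->
    (forall k, ('X - z%:P) *: f k = - mul_lambda f k) -> forall k, f k = 0.
Proof.
move=> gen fE; have [d d0 dP] := bounded_torsion _ _ _ _ gen.
have T0 : 'X - z%:P != 0 :> {poly F} by rewrite polyXsubC_eq0.
have ftor k : torsion (f k).
  exists (('X - z%:P) ^+ k.+1); first by rewrite expf_neq0.
  elim: k => [|k IHk]; first by rewrite expr1 fE oppr0.
  by rewrite exprSr -scalerA fE scalerN IHk oppr0.
(* Each factor ['X - z%:P] lowers the index by one up to sign, so [d *: f (k + m)] is [g *: f k] up
   to sign. *)
have [m [g gz def_d]] := multiplicity_XsubC d z; rewrite d0 /= in gz.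
have gf k : g *: f k = 0.
  have : d *: f (k + m)%N = 0 by exact: dP.
  rewrite def_d; elim: m {def_d} => [|m IHm]; first by rewrite expr0 mulr1 addn0.
  rewrite exprSr mulrA -scalerA addnS fE scalerN => /eqP.
  by rewrite oppr_eq0 => /eqP.
(* On an eigenvector for [z], [g] acts as the scalar [g.[z]], which is invertible. *)
have Tf k : ('X - z%:P) *: f k = 0 -> f k = 0.
  move=> Tfk; move: (gf k); rewrite (scale_eigen g Tfk).
  move/(congr1 ( *:%R (g.[z])^-1%:P)).
  by rewrite scalerA -polyCM mulVf // scale1r scaler0.
by elim=> [|k IHk]; apply: Tf; rewrite fE /= ?IHk oppr0.
Qed.

Section ClosedField.
Variables (F : closedFieldType) (A : lieConformalAlgebra F).
Variable V : genConformalModule A.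

Lemma act_torsion_eq0 : gc_finite V ->
  forall (a : A) (v : V) k, torsion v -> gc_act a v k = 0.
Proof.
move=> [n [e gen]] a v k /torsion_prod_XsubC[s].
elim: s v k => [|z s IHs] v k; first by rewrite big_nil scale1r => ->; exact: gc_act0.
(* The remaining factors kill [('X - z%:P) *: v], so [a] acts on it by zero; hence [d + lambda - z]
   kills the series of [v]. *)
rewrite big_cons mulrC -scalerA => /IHs act0; move: k.
apply: (shift_series_eq0 _ _ _ _ z _ gen) => k.
by apply/eqP; rewrite -addr_eq0 -gc_act_XsubC act0.
Qed.

Lemma torsion_submodule : gc_finite V -> gc_submodule (@torsion _ V).
Proof.
move=> Vfin; have tor0 : torsion (0 : V) by exists 1; rewrite ?oner_neq0 ?scaler0.
split=> // [v w [p p0 pv] [q q0 qw]|p v [q q0 qv]|a v k vtor].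
- exists (p * q); first by rewrite mulf_neq0.
  by rewrite scalerDr -[_ *: w]scalerA qw mulrC -scalerA pv !scaler0 addr0.
- by exists q => //; rewrite scalerA mulrC -scalerA qv scaler0.
by rewrite act_torsion_eq0.
Qed.

(** * Irreducible modules with trivial action *)

Hypothesis Virr : gc_irreducible V.

(** Under a zero action the multiples of [w] form a submodule, nonzero since it contains [w]. *)
Lemma trivial_cyclic : gc_trivial V ->
  forall w : V, w != 0 -> forall v, exists p : {poly F}, v = p *: w.
Proof.
move=> triv w w0.
have sub : gc_submodule (fun v : V => exists p : {poly F}, v = p *: w).
  split=> [|_ _ [p ->] [q ->]|p _ [q ->]|a v k _].
  - by exists 0; rewrite scale0r.
  - by exists (p + q); rewrite scalerDl.
  - by exists (p * q); rewrite scalerA.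
  by exists 0; rewrite triv scale0r.
have [Ww|] := Virr.2 _ sub; last by [].
case/eqP: w0; apply/Ww.
by exists 1; rewrite scale1r.
Qed.

Lemma trivial_irreducible_line : gc_trivial V ->
  exists alpha, gc_isomorphic V (trivial_line alpha A).
Proof.
move=> triv; have [[v v0] _] := Virr.
(* If ['X *: v] is nonzero it generates [v], so some [1 - p * 'X] kills [v]; its value 1 at 0 shows
   that it is nonzero. *)
have vtor : torsion v.
  have [Xv|Xv] := eqVneq ('X *: v) 0; first by exists 'X; rewrite ?polyX_eq0.
  have [p def_v] := trivial_cyclic triv _ Xv v.
  exists (1 - p * 'X); last by rewrite scalerBl scale1r -scalerA -def_v subrr.
  apply/eqP=> /(congr1 (horner^~ 0)) /eqP.
  by rewrite hornerD hornerN hornerMX hornerC horner0 mulr0 subr0 oner_eq0.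
have [z [w [w0 zw]]] := exists_eigenvector vtor v0.
(* The eigenvector [w] generates [V] and polynomials act on it through their values at [z], so
   scalars suffice. *)
have coordP u : exists c : F, u == c%:P *: w.
  have [p ->] := trivial_cyclic triv _ w0 u; exists p.[z].
  by rewrite (scale_eigen p zw).
pose f u : trivial_line z A := xchoose (coordP u).
have fP u : u = (f u : F)%:P *: w by apply/eqP/(xchooseP (coordP u)).
have winj (c c' : F) : c%:P *: w = c'%:P *: w -> c = c'.
  move/eqP; rewrite -subr_eq0 -scalerBl -polyCB => cw; apply/eqP.
  rewrite -subr_eq0; apply: contraNT w0 => cc'.
  rewrite -[w]scale1r -[1]/(1%:P) -(mulVf cc') polyCM -scalerA (eqP cw).
  by rewrite scaler0.
have flin : linear f.
  move=> p u u'; apply: winj; rewrite -fP.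
  rewrite -[RHS]/((p.[z] * (f u : F) + (f u' : F))%:P *: w).
  rewrite polyCD polyCM scalerDl -(fP u') [p.[z]%:P * _]mulrC -scalerA.
  by rewrite -(scale_eigen p zw) scalerA mulrC -scalerA -fP.
exists z.
pose flinear := GRing.isLinear.Build _ _ _ _ f flin.
exists (HB.pack_for {linear V -> trivial_line z A} f flinear); split=> /=.
  exists (fun c : trivial_line z A => (c : F)%:P *: w) => [u|c]; first by rewrite -fP.
  by apply: winj; rewrite -fP.
move=> a u k; rewrite triv; apply: winj; rewrite -fP.
by rewrite scale0r.
Qed.

End ClosedField.

(* The complex numbers are R[i] for an arbitrary model R of the reals. *)
Theorem proposition2p22 (R : realType) (A : lieConformalAlgebra R[i])
    (V : genConformalModule A) (Vfin : gc_finite V) (Virr : gc_irreducible V) :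
  (exists alpha : R[i], gc_isomorphic V (trivial_line alpha A))
  \/ (~ gc_trivial V /\ gc_free_finite_rank V).
Proof.
have [triv|ntriv] := pselect (gc_trivial V).
  by left; apply: trivial_irreducible_line.
right; split=> //; have [n [e gen]] := Vfin.
have [tor0|torV] := Virr.2 _ (torsion_submodule _ _ _ Vfin).
  by apply: torsion_free_basis gen => v /tor0.
by case: ntriv => a v k; apply: act_torsion_eq0.
Qed.
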